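(* Let $\lambda>0$ and $\Delta$ be fixed, and let $\mathcal{H}$ be a hypergraph on $n$ vertices with maximum degree $\Delta$ and minimum edge size $m$ such that $m\geq 2\lambda\Delta+1$. Then the Markov chain $\mathcal{M}(\mathcal{H})$ (the Glauber dynamics on independent sets of $\mathcal{H}$ with fugacity $\lambda$) has mixing time $O(n\log n)$.
   Context: A hypergraph $\mathcal{H}=(\mathcal{V},\mathcal{E})$ has a finite vertex set $\mathcal{V}$ with $|\mathcal{V}|=n$ and edges that are subsets of $\mathcal{V}$; the degree of a vertex is the number of edges containing it. A set $S\subseteq\mathcal{V}$ is independent if no edge is a subset of $S$. Let $\Omega(\mathcal{H})$ be the set of all independent sets of $\mathcal{H}$. The Markov chain $\mathcal{M}(\mathcal{H})$ with fugacity $\lambda>0$ has state space $\Omega(\mathcal{H})$ and the following transitions from $X_t$: select $v\in\mathcal{V}$ uniformly at random; (a) if $v\in X_t$, let $X_{t+1}=X_t\setminus\{v\}$ with probability $1/(1+\lambda)$; (b) if $v\notin X_t$ and $X_t\cup\{v\}$ is independent, let $X_{t+1}=X_t\cup\{v\}$ with probability $\lambda/(1+\lambda)$; (c) otherwise let $X_{t+1}=X_t$. Its stationary distribution $\pi$ gives each independent set $I$ probability proportional to $\lambda^{|I|}$. The mixing time is $\tau(\varepsilon)=\min\{t:\max_x d_{TV}(P^{t'}(x,\cdot),\pi)\le\varepsilon\ \text{for all }t'\ge t\}$, where $P$ is the transition matrix and $d_{TV}$ is total variation distance. The statement ''mixing time $O(n\log n)$'' is for fixed $\varepsilon\in(0,1)$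 as $n\to\infty$, with implied constant depending only on $\lambda,\Delta,\varepsilon$ (not on $\mathcal{H}$ otherwise). *)

(* Defs.v *)
From HB Require Import structures.
From mathcomp Require Import all_boot all_order all_algebra.
From mathcomp Require Import reals exp.

Set Implicit Arguments.
Unset Strict Implicit.
Unset Printing Implicit Defensive.

Import Order.TTheory GRing.Theory Num.Theory.
Local Open Scope ring_scope.

Definition hypergraph (T : finType) := {set {set T}}.

Definition degree (T : finType) (E : hypergraph T) (v : T) : nat :=
  #|[set e in E | v \in e]|.

Definition max_degree (T : finType) (E : hypergraph T) : nat :=
  (\max_(v : T) degree E v)%N.

(* Every edge has at most #|T| elements, so the default value #|T| matters
   only for the hypergraph without edges. *)
Definition min_edge_size (T : finType) (E : hypergraph T) : nat :=
  \big[minn/#|T|]_(e in E) #|e|.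

Definition independent (T : finType) (E : hypergraph T) (S : {set T}) : bool :=
  [forall e in E, ~~ (e \subset S)].

Record indep_set (T : finType) (E : hypergraph T) := IndepSet {
  indep_val :> {set T};
  indep_valP : independent E indep_val
}.

HB.instance Definition _ (T : finType) (E : hypergraph T) :=
  [isSub for @indep_val T E].
HB.instance Definition _ (T : finType) (E : hypergraph T) :=
  [Finite of indep_set E by <:].

Section Glauber.
Variables (R : realType) (lambda : R) (T : finType) (E : hypergraph T).

(* Probability of moving from X to Y given that the vertex v was selected. *)
Definition glauber_step (v : T) (X Y : {set T}) : R :=
  if v \in X then
    (1 + lambda)^-1 * (Y == X :\ v)%:R + lambda / (1 + lambda) * (Y == X)%:R
  else if independent E (v |: X) then
    lambda / (1 + lambda) * (Y == v |: X)%:R + (1 + lambda)^-1 * (Y == X)%:R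
  else (Y == X)%:R.

Definition glauber_trans (X Y : indep_set E) : R :=
  #|T|%:R^-1 * \sum_(v : T) glauber_step v (val X) (val Y).

Definition glauber_mx : 'M[R]_#|{: indep_set E}| :=
  \matrix_(i, j) glauber_trans (enum_val i) (enum_val j).

(* P^t(X, Y) *)
Definition glauber_pow (t : nat) (X Y : indep_set E) : R :=
  (glauber_mx ^+ t) (enum_rank X) (enum_rank Y).

Definition gibbs (I : indep_set E) : R :=
  lambda ^+ #|val I| / \sum_(J : indep_set E) lambda ^+ #|val J|.

End Glauber.

Definition dTV (R : realType) (A : finType) (mu nu : A -> R) : R :=
  2^-1 * \sum_(a : A) `|mu a - nu a|.

Section Mixing.
Variables (R : realType) (lambda : R) (T : finType) (E : hypergraph T).

(* Total variation distances are nonnegative, so the default value 0 does not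
   affect the maximum over the initial state. *)
Definition glauber_dist (t : nat) : R :=
  \big[Num.max/0]_(X : indep_set E)
    dTV (glauber_pow lambda t X) (gibbs lambda (E := E)).

Definition mixed_from (eps : R) (t : nat) : Prop :=
  forall t', (t <= t')%N -> glauber_dist t' <= eps.

Definition is_mixing_time (eps : R) (t : nat) : Prop :=
  mixed_from eps t /\ forall s, mixed_from eps s -> (t <= s)%N.

End Mixing.

(* Main.v *)
(* Path coupling in dual form, with a weighted metric.  The distance between
   X and X + w is c plus the sum, over the edges e through w, of f i, where i is
   the number of vertices of e - w missing from X and f is nonincreasing: only
   an edge with i = 1 can make the two chains separate further, and since m is
   large such an edge tends to regain missing vertices before it does harm.
   For f and c chosen in terms of lambda and Delta alone, the transition
   operator contracts Lipschitz constants by a factor 1 - k / n with k > 0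
   constant.  Applied to the sign of P^t(X, .) - pi, together with
   stationarity of pi, this bounds the distance to stationarity by
   O(n (1 - k / n)^t), which falls below eps after O(n log n) steps. *)

Require Import Defs.
From HB Require Import structures.
From mathcomp Require Import all_boot all_order all_algebra.
From mathcomp Require Import reals sequences exp boolp ring lra.

Set Implicit Arguments.
Unset Strict Implicit.
Unset Printing Implicit Defensive.

Import Order.TTheory GRing.Theory Num.Theory.
Local Open Scope ring_scope.

(** * Independent sets and the vertices that an edge is missing *)

Section IndependentSets.
Variables (T : finType) (E : hypergraph T).
Implicit Types (X Y : {set T}) (v w : T) (e : {set T}).

Lemma independentS X Y : X \subset Y -> independent E Y -> independent E X.
Proof.
move=> sXY /forall_inP indY; apply/forall_inP => e /indY.
by apply: contra => /subset_trans; apply.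
Qed.

Lemma independent_del X v : independent E X -> independent E (X :\ v).
Proof. exact/independentS/subsetDl. Qed.

(** Equal to X for v in X too, so every update at v is either a deletion or an insertion, with no
    case on v in X. *)
Definition insertion v X := if independent E (v |: X) then v |: X else X.

Lemma insertion_mem v X : v \in X -> insertion v X = X.
Proof. by rewrite /insertion => vX; rewrite setUC (setUidPl _) ?sub1set ?if_same. Qed.

Lemma del_notin v X : v \notin X -> X :\ v = X.
Proof. by move=> vX; apply/setDidPl; rewrite disjoint_sym disjoints1. Qed.

(** Leaving out w gives X and [w |: X] the same count, which thus belongs to the pair. *)
Definition missing X w e := #|(e :\ w) :\: X|.

(** With nothing missing, e would lie inside [w |: X]. Hence [f 0] never occurs in the weight of a
    pair of independent sets, only in a formal step down from i = 1. *)
Lemma missing_gt0 X w e : e \in E -> w \in e -> independent E (w |: X) ->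
  (0 < missing X w e)%N.
Proof.
move=> eE we /forall_inP/(_ e eE); rewrite /missing card_gt0; apply: contra.
by rewrite -subDset -setD_eq0 => /eqP <-.
Qed.

Lemma missing_del X w e v : v != w -> v \in X -> v \in e ->
  missing (X :\ v) w e = (missing X w e).+1.
Proof.
move=> vw vX ve; rewrite /missing (cardsD1 v) !inE vw ve eqxx /= add1n.
congr (_.+1); apply: eq_card => u; rewrite !inE.
by case: eqVneq => // ->; rewrite vX.
Qed.

Lemma missing_del_notin X w e v : v \notin e ->
  missing (X :\ v) w e = missing X w e.
Proof.
move=> ve; apply: eq_card => u; rewrite !inE.
by case: (eqVneq u v) => // ->; rewrite (negbTE ve) !andbF.
Qed.

Lemma missing_add X w e v : v != w -> v \notin X -> v \in e ->
  missing (v |: X) w e = (missing X w e).-1.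
Proof.
move=> vw vX ve; rewrite /missing [in RHS](cardsD1 v) !inE vw ve vX /= add0n.
by apply: eq_card => u; rewrite !inE negb_or -andbA.
Qed.

Lemma missing_add_notin X w e v : v \notin e ->
  missing (v |: X) w e = missing X w e.
Proof.
move=> ve; apply: eq_card => u; rewrite !inE.
by case: (eqVneq u v) => // ->; rewrite (negbTE ve) !andbF.
Qed.

(** A lower bound on the size of e thereby forces many vertices of e into X when few are missing. *)
Lemma card_missing X w e : w \notin X -> w \in e ->
  #|e| = (#|e :&: X| + (missing X w e).+1)%N.
Proof.
move=> wX we; rewrite (cardsD1 w) we -(cardsID X (e :\ w)) /missing.
rewrite add1n -addnS; congr ((_ + _.+1)%N).
by apply: eq_card => u; rewrite !inE; case: eqVneq => // ->; rewrite (negbTE wX) !andbF.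
Qed.

(** An edge inside [v |: (w |: X)] that avoided w or v would already violate the independence of
    [v |: X] or [w |: X]. *)
Lemma blocking_edge X w v : w \notin X -> v != w -> v \notin X ->
  independent E (w |: X) -> independent E (v |: X) ->
  ~~ independent E (v |: (w |: X)) ->
  exists e, [/\ e \in E, w \in e, v \in e & missing X w e = 1%N].
Proof.
move=> wX vw vX /forall_inP indw /forall_inP indv.
rewrite negb_forall_in => /exists_inP[e eE]; rewrite negbK => sub.
have we : w \in e.
  apply: contraT => we; have /negP[] := indv e eE; apply/subsetP => u ue.
  have := subsetP sub u ue; rewrite !inE.
  by case: (eqVneq u w) => // uw; by rewrite -uw ue in we.
have ve : v \in e.
  apply: contraT => ve; have /negP[] := indw e eE; apply/subsetP => u ue.
  have := subsetP sub u ue; rewrite !inE.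
  by case: (eqVneq u v) => // uv; by rewrite -uv ue in ve.
exists e; split=> //; rewrite /missing -(cards1 v); apply: eq_card => u.
rewrite !inE; case: (eqVneq u v) => [->|uv]; first by rewrite vX vw ve.
case ue: (u \in e); rewrite ?andbF ?andbT //.
by have := subsetP sub u ue; rewrite !inE (negbTE uv) /= => /orP[]->; rewrite ?andbF.
Qed.

Lemma degree_le_max v : (degree E v <= max_degree E)%N.
Proof. exact: (leq_bigmax (F := degree E)). Qed.

Lemma min_edge_size_le e : e \in E -> (min_edge_size E <= #|e|)%N.
Proof.
move=> eE; rewrite /min_edge_size.
elim: (index_enum _) (mem_index_enum e) => // e0 s IH.
rewrite inE big_cons => /predU1P[<-|/IH le_e]; first by rewrite eE geq_minl.
by case: ifP => // _; apply: leq_trans (geq_minr _ _) le_e.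
Qed.

End IndependentSets.

(** * Path coupling: contraction of Lipschitz constants *)

Section Contraction.
Variables (R : realType) (lambda : R) (T : finType) (E : hypergraph T).
Implicit Types (X Y : {set T}) (v w : T) (e : {set T}) (F : {set T} -> R) (L : R).
Hypothesis lambda_gt0 : 0 < lambda.

Local Notation p := ((1 + lambda)^-1).
Local Notation q := (lambda / (1 + lambda)).

Definition site_update v F X := p * F (X :\ v) + q * F (insertion E v X).

Definition glauber_op F X := #|T|%:R^-1 * \sum_(v : T) site_update v F X.

Variables (f : nat -> R) (c : R).

Definition weight X w := c + \sum_(e in E | w \in e) f (missing X w e).

Definition lipschitz L F := forall X w, w \notin X -> independent E (w |: X) ->
  `|F (w |: X) - F X| <= L * weight X w.

Hypothesis c_gt0 : 0 < c.
Hypothesis f_ge0 : forall i, 0 <= f i.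
Hypothesis f_noninc : forall i, f i.+1 <= f i.
Hypothesis f0E : f 0 = f 1 + (c + (max_degree E)%:R * f 1).
(** Drift of one edge, scaled by 1 + lambda: a present vertices may be deleted and i missing ones
    inserted. It must not exceed the f i that vanishes when w itself is updated. *)
Hypothesis f_edge : forall a i, (0 < i)%N -> (min_edge_size E <= a + i.+1)%N ->
  a%:R * (f i.+1 - f i) + lambda * i%:R * (f i.-1 - f i) <= (1 + lambda) * f i.

Local Notation G := (c + (max_degree E)%:R * f 1).

Lemma weight_gec X w : c <= weight X w.
Proof. by rewrite lerDl sumr_ge0. Qed.

Lemma f_le1 i : (0 < i)%N -> f i <= f 1.
Proof. by elim: i => // -[|i] // /(_ isT) IH _; apply: le_trans IH. Qed.

Lemma weight_le X w : independent E (w |: X) -> weight X w <= G.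
Proof.
move=> ind; rewrite lerD2l.
apply: (@le_trans _ _ (\sum_(e in E | w \in e) f 1)).
  by apply: ler_sum => e /andP[eE we]; apply/f_le1/(missing_gt0 eE we).
rewrite (eq_bigl (fun e => e \in [set e in E | w \in e])); last first.
  by move=> e; rewrite inE.
rewrite sumr_const -[leLHS]mulr_natl ler_wpM2r // ler_nat.
exact: degree_le_max.
Qed.

(** Expected change of the weight under an update of v whose insertions always succeed. For a
    blocked insertion this only overestimates, since f is nonincreasing. *)
Definition drift X w v := \sum_(e in E | w \in e) (v \in e)%:R *
  (if v \in X then p * (f (missing X w e).+1 - f (missing X w e))
   else q * (f (missing X w e).-1 - f (missing X w e))).

Let G_gt0 : 0 < G. Proof. by rewrite ltr_wpDr // mulr_ge0. Qed.

Let rate_ge0 : (0 < #|T|)%N -> 0 <= 1 - c / G / #|T|%:R.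
Proof.
move=> T_gt0; rewrite subr_ge0 ler_pdivrMr ?ltr0n // mul1r.
apply: (@le_trans _ _ 1); last by rewrite ler1n.
by rewrite ler_pdivrMr // mul1r lerDl mulr_ge0.
Qed.

Let p_gt0 : 0 < p. Proof. by rewrite invr_gt0 addr_gt0. Qed.
Let q_gt0 : 0 < q. Proof. by rewrite mulr_gt0. Qed.
Let pqE : p + q = 1. Proof. by rewrite -{1}[p]mul1r -mulrDl divff ?gt_eqF ?addr_gt0. Qed.

Let pq_split x : x = p * x + q * x. Proof. by rewrite -mulrDl pqE mul1r. Qed.

Lemma weight_del X w v : v != w -> v \in X ->
  p * weight (X :\ v) w + q * weight X w = weight X w + drift X w v.
Proof.
move=> vw vX; rewrite [in RHS](pq_split (weight X w)) addrAC; congr (_ + _).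
rewrite /weight /drift !mulrDr -addrA; congr (_ + _).
rewrite !mulr_sumr -big_split /=; apply: eq_bigr => e _.
rewrite vX; case: (boolP (v \in e)) => ve.
  by rewrite missing_del // mul1r; ring.
by rewrite missing_del_notin // mul0r addr0.
Qed.

Lemma weight_add X w v : v != w -> v \notin X ->
  p * weight X w + q * weight (v |: X) w = weight X w + drift X w v.
Proof.
move=> vw vX; rewrite [in RHS](pq_split (weight X w)) -addrA; congr (_ + _).
rewrite /weight /drift !mulrDr -addrA; congr (_ + _).
rewrite !mulr_sumr -big_split /=; apply: eq_bigr => e _.
rewrite (negbTE vX); case: (boolP (v \in e)) => ve.
  by rewrite missing_add // mul1r; ring.
by rewrite missing_add_notin // mul0r addr0.
Qed.

Lemma drift_ge0 X w v : v \notin X -> 0 <= drift X w v.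
Proof.
move=> vX; apply: sumr_ge0 => e _; rewrite (negbTE vX) mulr_ge0 //.
apply: mulr_ge0; first exact: ltW.
by rewrite subr_ge0; case: missing => //= n.
Qed.

(* The value f 0 was chosen so that the jump f 0 - f 1 pays for the whole
   weight of the pair X, v |: X. *)
Lemma drift_blocked X w v : w \notin X -> v != w -> v \notin X ->
  independent E (w |: X) -> independent E (v |: X) ->
  ~~ independent E (v |: (w |: X)) -> q * weight X v <= drift X w v.
Proof.
move=> wX vw vX indw indv nind.
have [e [eE we ve e1]] := blocking_edge wX vw vX indw indv nind.
rewrite /drift (bigD1 e) ?eE //= (negbTE vX) ve e1 /= mul1r f0E.
rewrite [f 1 + _]addrC addrK -[leLHS]addr0 lerD //.
  by rewrite ler_pM2l // weight_le.
apply: sumr_ge0 => e' _; rewrite mulr_ge0 // mulr_ge0 ?(ltW q_gt0) //.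
by rewrite subr_ge0; case: missing => //= n.
Qed.

(** Exchanging the sums isolates one edge at a time; [f_edge] bounds its total drift by its own term
    f i of the weight. *)
Lemma drift_sum X w : w \notin X -> independent E (w |: X) ->
  \sum_(v | v != w) drift X w v <= weight X w - c.
Proof.
move=> wX ind; rewrite exchange_big /= [leRHS]addrC addKr.
apply: ler_sum => e /andP[eE we]; set i := missing X w e.
have i_gt0 : (0 < i)%N by exact: missing_gt0 eE we ind.
have := f_edge (a := #|e :&: X|) i_gt0.
rewrite -(card_missing wX we) => /(_ (min_edge_size_le eE)) le_e.
rewrite (bigID (fun v => v \in X)) /=.
rewrite (eq_bigr (fun v => (v \in e)%:R * (p * (f i.+1 - f i)))); last first.
  by move=> v /andP[_ ->].
rewrite [X in _ + X](eq_bigr (fun v => (v \in e)%:R * (q * (f i.-1 - f i)))); last first.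
  by move=> v /andP[_ /negbTE ->].
rewrite -!mulr_suml.
have -> : \sum_(v | (v != w) && (v \in X)) (v \in e)%:R = #|e :&: X|%:R :> R.
  rewrite -sum1_card natr_sum big_mkcond [RHS]big_mkcond; apply: eq_bigr => v _ /=.
  rewrite inE; case: eqVneq => [->|_] /=; first by rewrite (negbTE wX) andbF.
  by case: (v \in e); case: (v \in X).
have -> : \sum_(v | (v != w) && (v \notin X)) (v \in e)%:R = i%:R :> R.
  rewrite /i /missing -sum1_card natr_sum big_mkcond [RHS]big_mkcond.
  apply: eq_bigr => v _ /=; rewrite !inE.
  by case: (v == w); case: (v \in e); case: (v \in X).
rewrite [X in X <= _](_ : _ = p * (#|e :&: X|%:R * (f i.+1 - f i)
    + lambda * i%:R * (f i.-1 - f i))); last by ring.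
by rewrite mulrC ler_pdivrMr ?[_ * (1 + _)]mulrC // addr_gt0.
Qed.

(** Dual of the coupling that uses the same v and the same coin. At v = w the chains merge; if both
    sets accept or both reject v, they still differ in w alone; if only X accepts v, [drift_blocked]
    pays for the separation. *)
Lemma site_update_diff L F X w v : 0 <= L -> lipschitz L F ->
  w \notin X -> independent E (w |: X) ->
  `|site_update v F (w |: X) - site_update v F X| <=
    L * (if v == w then 0 else weight X w + drift X w v).
Proof.
move=> L0 lipF wX indw.
have indX : independent E X by apply: independentS indw; exact: subsetUr.
rewrite /site_update.
have le_pq a b a' b' A B : `|a - a'| <= L * A -> `|b - b'| <= L * B ->
    `|p * a + q * b - (p * a' + q * b')| <= L * (p * A + q * B).
  move=> le_a le_b; rewrite opprD addrACA -!mulrBr.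
  apply: le_trans (ler_normD _ _) _.
  rewrite (normrM p) (normrM q) (gtr0_norm p_gt0) (gtr0_norm q_gt0).
  have := ler_wpM2l (ltW p_gt0) le_a; have := ler_wpM2l (ltW q_gt0) le_b.
  lra.
case: eqVneq => [->|vw].
  rewrite setU1K // del_notin // insertion_mem ?setU11 //.
  by rewrite /insertion indw subrr normr0 mulr0.
have delE : (w |: X) :\ v = w |: (X :\ v).
  apply/setP => u; rewrite !inE; case: (eqVneq u w) => [->|] //=.
  by rewrite eq_sym vw.
have [vX|vX] := boolP (v \in X).
  rewrite -weight_del // !insertion_mem ?inE ?vX ?orbT //.
  apply: le_pq; last exact: lipF.
  rewrite delE; apply: lipF; first by rewrite !inE negb_and wX orbT.
  by rewrite -delE; apply: independent_del.
have vwX : v \notin w |: X by rewrite !inE negb_or vw.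
rewrite !del_notin // /insertion.
have := lipF _ _ wX indw => lipw.
have [ind|nind] := boolP (independent E (v |: (w |: X))).
  have indv : independent E (v |: X).
    by apply: independentS ind; rewrite setUS // subsetUr.
  rewrite indv -weight_add //; apply: le_pq => //.
  rewrite setUCA; apply: lipF; first by rewrite !inE negb_or eq_sym vw.
  by rewrite setUCA.
have [indv|nindv] := boolP (independent E (v |: X)).
  have := drift_blocked wX vw vX indw indv nind => le_d.
  (* The path from [w |: X] to [v |: X] goes through X. *)
  have lipv : `|F (w |: X) - F (v |: X)| <= L * (weight X w + weight X v).
    rewrite mulrDr; apply: le_trans (ler_distD (F X) _ _) _.
    by rewrite lerD // distrC; exact: lipF.
  apply: le_trans (le_pq _ _ _ _ _ _ lipw lipv) _.
  by rewrite ler_wpM2l // (mulrDr q) addrA -mulrDl pqE mul1r lerD2l.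
apply: le_trans (le_pq _ _ _ _ _ _ lipw lipw) _.
by rewrite ler_wpM2l // -mulrDl pqE mul1r lerDl drift_ge0.
Qed.

(** Merging at v = w gains the weight and the other drifts cost at most the weight less c, so the n
    updates sum to at most n times the weight, less c. As no weight exceeds G, the additive gain c
    is a relative gain of at least c / G. *)
Lemma glauber_op_lipschitz L F : 0 <= L -> lipschitz L F ->
  lipschitz (L * (1 - c / G / #|T|%:R)) (glauber_op F).
Proof.
move=> L0 lipF X w wX ind; rewrite /glauber_op.
have T_gt0 : 0 < #|T|%:R :> R by rewrite ltr0n; apply/card_gt0P; exists w.
rewrite -mulrBr -sumrB normrM gtr0_norm ?invr_gt0 // ler_pdivrMl //.
apply: le_trans (ler_norm_sum _ _ _) _.
apply: le_trans (ler_sum _ (fun v _ => site_update_diff v L0 lipF wX ind)) _.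
rewrite -mulr_sumr [leRHS](_ : _ =
  L * (#|T|%:R * weight X w - c * (weight X w / G))); last first.
  by field; rewrite ?gt_eqF.
apply: ler_wpM2l => //.
have le_c : c * (weight X w / G) <= c.
  by rewrite -[leRHS]mulr1 ler_pM2l // ler_pdivrMr // mul1r weight_le.
rewrite (bigD1 w) //= eqxx add0r.
rewrite (eq_bigr (fun v => weight X w + drift X w v)); last by move=> v /negbTE ->.
rewrite big_split /= sumr_const cardC1 -[Y in Y + _]mulr_natl.
have := drift_sum wX ind.
have -> : #|T|.-1%:R = #|T|%:R - 1 :> R.
  by rewrite -[in RHS](ltn_predK (_ : (0 < #|T|)%N)) -?(ltr0n R) // -natr1 addrK.
lra.
Qed.

Lemma iter_glauber_op_lipschitz L F t : (0 < #|T|)%N -> 0 <= L ->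
  lipschitz L F ->
  lipschitz (L * (1 - c / G / #|T|%:R) ^+ t) (iter t glauber_op F).
Proof.
move=> T_gt0 L0 lipF.
have rate0 := rate_ge0 T_gt0.
elim: t => [|t IH]; first by rewrite expr0 mulr1.
by rewrite exprSr mulrA; apply: glauber_op_lipschitz => //; rewrite mulr_ge0 // exprn_ge0.
Qed.

(** Deleting the vertices one by one stays within independent sets, each step costing at most G. *)
Lemma lipschitz_dist_set0 L F X : 0 <= L -> lipschitz L F -> independent E X ->
  `|F X - F set0| <= L * (#|X|%:R * G).
Proof.
move=> L0 lipF; elim: {X}#|X| {-2}X (erefl #|X|) => [|n IH] X cX ind.
  by rewrite (cards0_eq cX) subrr normr0 cards0 mul0r mulr0.
have [w wX] : exists w, w \in X by apply/set0Pn; rewrite -card_gt0 cX.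
have cX' : #|X :\ w| = n by move: cX; rewrite (cardsD1 w) wX => -[].
have indw : independent E (w |: X :\ w) by rewrite setD1K.
apply: le_trans (ler_distD (F (X :\ w)) _ _) _.
have := IH _ cX' (independent_del w ind).
have := lipF (X :\ w) w; rewrite setD11 setD1K // => /(_ isT ind).
have := ler_wpM2l L0 (weight_le indw).
by rewrite cX cX' -(natr1 n); lra.
Qed.

Lemma lipschitz_bounded F : (forall X, `|F X| <= 1) -> lipschitz (2 / c) F.
Proof.
move=> F1 X w _ _; apply: (@le_trans _ _ 2).
  by have := ler_normB (F (w |: X)) (F X); have := F1 X; have := F1 (w |: X); lra.
by rewrite -mulrA ler_peMr // mulrC ler_pdivlMr // mul1r weight_gec.
Qed.

Lemma iter_glauber_op_diff F t X Y : (forall X, `|F X| <= 1) ->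
  (0 < #|T|)%N -> independent E X -> independent E Y ->
  `|iter t glauber_op F X - iter t glauber_op F Y| <=
    4 * (G / c) * #|T|%:R * (1 - c / G / #|T|%:R) ^+ t.
Proof.
move=> F1 T_gt0 indX indY.
have := iter_glauber_op_lipschitz t T_gt0 _ (lipschitz_bounded F1).
have -> : 0 <= 2 / c by rewrite divr_ge0 // ltW.
move=> /(_ isT); set L := _ * _ ^+ _ => lip.
have L_ge0 : 0 <= L.
  rewrite mulr_ge0 ?divr_ge0 ?(ltW c_gt0) // exprn_ge0 //.
  exact: rate_ge0.
have bound Z : independent E Z ->
    `|iter t glauber_op F Z - iter t glauber_op F set0| <= L * (#|T|%:R * G).
  move=> indZ; apply: le_trans (lipschitz_dist_set0 L_ge0 lip indZ) _.
  by rewrite ler_wpM2l // ler_pM2r // ler_nat max_card.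
apply: le_trans (ler_distD (iter t glauber_op F set0) _ _) _.
(* The 4 is 2 from the initial Lipschitz constant 2 / c, doubled by the two paths to the empty
   set. *)
have -> : 4 * (G / c) * #|T|%:R * (1 - c / G / #|T|%:R) ^+ t =
  L * (#|T|%:R * G) + L * (#|T|%:R * G) by rewrite /L; ring.
by rewrite lerD // ?[`|iter t glauber_op F set0 - _|]distrC bound.
Qed.

End Contraction.

(** * Reversibility, stationarity and total variation distance *)

Section Chain.
Variables (R : realType) (lambda : R) (T : finType) (E : hypergraph T).
Hypothesis lambda_gt0 : 0 < lambda.
Implicit Types (X Y Z : indep_set E) (F : {set T} -> R).

Local Notation P := (glauber_op lambda E).
Local Notation "'pi'" := (gibbs lambda (E := E)).

Lemma sum_indep_eq F (A : {set T}) : independent E A ->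
  \sum_(Y : indep_set E) (val Y == A)%:R * F (val Y) = F A.
Proof.
move=> indA; rewrite (bigD1 (IndepSet indA)) //= eqxx mul1r big1 ?addr0 // => Y.
by rewrite -val_eqE => /negbTE ->; rewrite mul0r.
Qed.

Lemma glauber_stepE v F X :
  \sum_(Y : indep_set E) glauber_step lambda E v (val X) (val Y) * F (val Y) =
    site_update lambda E v F (val X).
Proof.
have indX := indep_valP X; have indD := independent_del v indX.
have sum2 (a b : R) (A B : {set T}) : independent E A -> independent E B ->
    \sum_(Y : indep_set E) (a * (val Y == A)%:R + b * (val Y == B)%:R) * F (val Y) =
    a * F A + b * F B.
  move=> indA indB; rewrite -(sum_indep_eq F indA) -(sum_indep_eq F indB).
  rewrite !mulr_sumr -big_split /=; apply: eq_bigr => Y _.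
  by rewrite mulrDl !mulrA.
rewrite /glauber_step /site_update; have [vX|vX] := boolP (v \in val X).
  by rewrite insertion_mem // sum2.
rewrite del_notin // /insertion; case: ifP => ind.
  by rewrite sum2 // addrC.
rewrite (sum_indep_eq F indX) -mulrDl -{1}[_^-1]mul1r -mulrDl divff ?mul1r //.
by rewrite gt_eqF ?addr_gt0.
Qed.

Lemma glauber_transE F X :
  \sum_(Y : indep_set E) glauber_trans lambda X Y * F (val Y) = P F (val X).
Proof.
rewrite /glauber_op -(eq_bigr _ (fun v _ => glauber_stepE v F X)) exchange_big.
rewrite mulr_sumr; apply: eq_bigr => Y _.
by rewrite /glauber_trans -mulrA mulr_suml.
Qed.

Lemma glauber_powE t F X :
  \sum_(Y : indep_set E) glauber_pow lambda t X Y * F (val Y) = iter t P F (val X).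
Proof.
elim: t X => [|t IH] X.
  rewrite /= -(sum_indep_eq F (indep_valP X)); apply: eq_bigr => Y _.
  by rewrite /glauber_pow expr0 mxE (inj_eq enum_rank_inj) eq_sym val_eqE.
rewrite iterS -glauber_transE.
under [RHS]eq_bigr do rewrite -IH mulr_sumr.
rewrite exchange_big; apply: eq_bigr => Y _.
rewrite /glauber_pow exprS mxE (reindex enum_rank) /=; last first.
  exact: onW_bij (enum_rank_bij _).
rewrite mulr_suml; apply: eq_bigr => Z _.
by rewrite mxE !enum_rankK mulrA.
Qed.

(** Adding v multiplies the Gibbs weight by lambda, which is also the ratio of the deletion to the
    insertion probability, inverted. Distinct sets both avoiding v are not linked by an update at
    v. *)
Lemma glauber_step_reversible v X Y :
  lambda ^+ #|val X| * glauber_step lambda E v (val X) (val Y) =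
  lambda ^+ #|val Y| * glauber_step lambda E v (val Y) (val X).
Proof.
have move_balance (A B : {set T}) : v \in A -> independent E A ->
    A != B -> lambda ^+ #|A| * glauber_step lambda E v A B =
              lambda ^+ #|B| * glauber_step lambda E v B A.
  move=> vA indA AB.
  rewrite /glauber_step vA [B == A]eq_sym (negbTE AB) !mulr0 !addr0.
  have [eB|nB] := eqVneq B (A :\ v).
    rewrite eB setD11 setD1K // indA eqxx (cardsD1 v A) vA exprS.
    by ring.
  rewrite !mulr0; case: ifP => vB.
    rewrite [A == _](_ : _ = false) ?mulr0 ?add0r ?mulr0 //.
    by apply/eqP => eA; move: vA; rewrite eA setD11.
  case: ifP => _; last by rewrite mulr0.
  rewrite [A == _](_ : _ = false) ?mulr0 //.
  by apply/eqP => eA; case/eqP: nB; rewrite eA setU1K ?vB.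
have [->//|XY] := eqVneq (val X) (val Y).
have [vX|vX] := boolP (v \in val X); first exact: move_balance (indep_valP X) _.
have [vY|vY] := boolP (v \in val Y).
  by rewrite -move_balance ?(indep_valP Y) // eq_sym.
have stay (A B : {set T}) : v \notin A -> v \notin B -> A != B ->
    glauber_step lambda E v A B = 0.
  move=> vA vB AB; rewrite /glauber_step (negbTE vA) [B == A]eq_sym (negbTE AB) mulr0 addr0.
  case: ifP => // _; rewrite [B == _](_ : _ = false) ?mulr0 //.
  by apply/eqP => eB; move: vB; rewrite eB setU11.
by rewrite !stay ?mulr0 // eq_sym.
Qed.

Lemma glauber_reversible X Y :
  pi X * glauber_trans lambda X Y = pi Y * glauber_trans lambda Y X.
Proof.
have swap (a z n u : R) : a * z * (n * u) = z * n * (a * u).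
  by rewrite (mulrC a) mulrACA.
rewrite /gibbs /glauber_trans swap [RHS]swap; congr (_ * _).
by rewrite !mulr_sumr; apply: eq_bigr => v _; exact: glauber_step_reversible.
Qed.

Lemma gibbs_ge0 X : 0 <= pi X.
Proof.
have l_ge0 := ltW lambda_gt0.
by rewrite divr_ge0 ?sumr_ge0 // => *; rewrite exprn_ge0.
Qed.

(** The argument X witnesses that independent sets exist; there are none when the empty set is an
    edge. *)
Lemma gibbs_sum X : \sum_(Y : indep_set E) pi Y = 1.
Proof.
rewrite -mulr_suml divff // gt_eqF // (bigD1 X) //= ltr_wpDr ?exprn_gt0 //.
by apply: sumr_ge0 => *; rewrite exprn_ge0 // ltW.
Qed.

Lemma glauber_op1 A : (0 < #|T|)%N -> P (fun=> 1) A = 1.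
Proof.
move=> T_gt0; rewrite /glauber_op (eq_bigr (fun=> 1)) => [|v _].
  by rewrite sumr_const mulVf // gt_eqF // ltr0n.
rewrite /site_update !mulr1 -{1}[_^-1]mul1r -mulrDl divff //.
by rewrite gt_eqF ?addr_gt0.
Qed.

Lemma gibbs_stationary t F : (0 < #|T|)%N ->
  \sum_(X : indep_set E) pi X * iter t P F (val X) = \sum_(X : indep_set E) pi X * F (val X).
Proof.
move=> T_gt0; elim: t => // t IH; rewrite -{}IH iterS.
under eq_bigr do rewrite -glauber_transE mulr_sumr.
rewrite exchange_big; apply: eq_bigr => Y _ /=.
under eq_bigr do rewrite mulrA glauber_reversible mulrAC.
rewrite -mulr_sumr -[RHS]mulr1 -(glauber_op1 (val Y) T_gt0) -glauber_transE.
by congr (_ * _); apply: eq_bigr => X _; rewrite mulr1.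
Qed.

(** For F the sign of P^t(X, .) - pi, extended by 0 to dependent sets, the L1 distance is P^t F(X) -
    pi(F). By stationarity this is the pi-average over Y of P^t F(X) - P^t F(Y). *)
Lemma glauber_dist_le t B : 0 <= B -> (0 < #|T|)%N ->
  (forall F X Y, (forall A, `|F A| <= 1) ->
    `|iter t P F (val X) - iter t P F (val Y)| <= B) ->
  glauber_dist lambda E t <= B / 2.
Proof.
move=> B_ge0 T_gt0 le_B; apply: bigmax_le; first by rewrite divr_ge0.
move=> X _; rewrite /dTV mulrC ler_pM2r ?invr_gt0 //.
pose F A : R := if insub A is Some Y
  then Num.sg (glauber_pow lambda t X Y - pi Y) else 0.
have F1 A : `|F A| <= 1.
  rewrite /F; case: insub => [Y|]; last by rewrite normr0.
  by rewrite normr_sg lern1; case: eqP.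
rewrite (eq_bigr (fun Y => glauber_pow lambda t X Y * F (val Y) - pi Y * F (val Y))).
  rewrite sumrB glauber_powE -(gibbs_stationary t) //.
  rewrite -[_ (val X)]mul1r -(gibbs_sum X) mulr_suml -sumrB.
  rewrite -[B]mul1r -(gibbs_sum X) mulr_suml; apply: ler_sum => Y _.
  rewrite -mulrBr ler_wpM2l ?gibbs_ge0 //.
  exact: le_trans (ler_norm _) (le_B F X Y F1).
by move=> Y _; rewrite /F valK -mulrBl mulrC normrEsg.
Qed.

End Chain.

(** * Choice of the weights and of the time horizon *)

(* The hypothesis on m enters only at i = 1 and i = 2, as a >= 2 lambda Delta - i.
   For Delta <= 1 the constant weight suffices; for Delta >= 2 the values 1, 1/2,
   3/8 are rounded up from the probabilities that an edge with i missing vertices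
   ever becomes critical before w is updated. *)
Lemma edge_weights (R : realType) (lambda : R) (Delta : nat) : 0 < lambda ->
  exists (c : R) (f : nat -> R),
    [/\ 0 < c, forall i, 0 <= f i, forall i, f i.+1 <= f i,
        f 0 = f 1 + (c + Delta%:R * f 1) &
        forall m : nat, 2 * lambda * Delta%:R + 1 <= m%:R ->
        forall a i, (0 < i)%N -> (m <= a + i.+1)%N ->
        a%:R * (f i.+1 - f i) + lambda * i%:R * (f i.-1 - f i) <=
          (1 + lambda) * f i].
Proof.
move=> l_gt0.
have D_ge0 : 0 <= Delta%:R :> R by [].
have [D1|D2] := leqP Delta 1.
  (* With f constant from 1 on, only i = 1 binds: lambda (1 / lambda + Delta) <= 1 + lambda. *)
  exists lambda^-1, (fun i => if i is 0 then 1 + (lambda^-1 + Delta%:R) else 1).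
  split=> [||[|i]||m _ a [|[|i]] // _ _] //.
  - by rewrite invr_gt0.
  - by case=> // ; rewrite !addr_ge0 // invr_ge0 ltW.
  - by rewrite lerDl addr_ge0 // invr_ge0 ltW.
  - by rewrite mulr1.
  - have : Delta%:R <= 1 :> R by rewrite lern1.
    rewrite -(ler_pM2l l_gt0) mulr1 => lD.
    have -> : 1 + (lambda^-1 + Delta%:R) - 1 = lambda^-1 + Delta%:R :> R by ring.
    by rewrite subrr mulr0 add0r !mulr1 mulrDr divff ?gt_eqF // lerD2l.
  - by rewrite /= subrr !mulr0 addr0 mulr1 addr_ge0 // ltW.
pose G : R := (2 * lambda)^-1 + Delta%:R.
have G_ge0 : 0 <= G by rewrite addr_ge0 // invr_ge0 mulr_ge0 // ltW.
have lG : lambda * G = 2^-1 + lambda * Delta%:R.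
  by rewrite mulrDr invfM mulrCA divff ?gt_eqF // mulr1.
have lD : lambda * 2 <= lambda * Delta%:R by rewrite ler_pM2l // (ler_nat R 2).
exists (2 * lambda)^-1, (fun i => match i with
  0 => 1 + G | 1 => 1 | 2 => 1 / 2 | _ => 3 / 8 end).
split=> [||||m le_m].
- by rewrite invr_gt0 mulr_gt0.
- by case=> [|[|[|i]]]; lra.
- by case=> [|[|[|i]]]; lra.
- by rewrite mulr1.
move=> a i i_gt0 le_ma.
have a_ge0 : 0 <= a%:R :> R by [].
have : m%:R <= a%:R + i.+1%:R :> R by rewrite -natrD ler_nat.
case: i i_gt0 {le_ma} => // -[|[|[|i]]] _ le_ma.
(* At i = 1, a >= 2 lambda Delta - 1 gives - a / 2 <= 1 / 2 - lambda Delta, which with lambda G sums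
   to at most 1. *)
- have -> : 1 + G - 1 = G by ring.
  by rewrite !mulr1 lG; lra.
(* At i = 2 the left side is at most 1 / 4 + lambda - lambda Delta / 4, and Delta >= 2 suffices. *)
- by rewrite /=; lra.
- by rewrite /=; lra.
- by rewrite /= !subrr !mulr0 addr0; apply: mulr_ge0; lra.
Qed.

(** Since (1 - k / n)^t <= exp (- k t / n), any t beyond (n / k) (ln n + ln (2 / (k eps))) is
    enough. *)
Lemma mixing_horizon (R : realType) (k eps : R) :
  0 < k -> k <= 1 -> 0 < eps -> eps < 1 ->
  exists (C : R) (N : nat), forall n : nat, (N <= n)%N ->
    [/\ (0 < n)%N & exists2 t0 : nat, t0%:R <= C * (n%:R * ln n%:R) &
      forall t, (t0 <= t)%N -> 2 / k * n%:R * (1 - k / n%:R) ^+ t <= eps].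
Proof.
move=> k_gt0 k_le1 eps_gt0 eps_lt1.
have r_gt0 : 0 < 2 / (k * eps) by rewrite divr_gt0 ?mulr_gt0.
pose K : R := ln (2 / (k * eps)).
have K_ge0 : 0 <= K.
  apply: ln_ge0; rewrite ler_pdivlMr ?mulr_gt0 // mul1r.
  have : k * eps <= 1 by rewrite mulr_ile1 // ltW.
  lra.
(* N exceeds e, so ln n >= 1 and K <= K ln n; the final + 1 in C absorbs rounding the time up to an
   integer. *)
exists ((1 + K) / k + 1), (Num.truncn (expR (1 : R))).+1 => n le_n.
have n_gt0 : (0 < n)%N by exact: leq_trans le_n.
split=> //.
have nR : 0 < n%:R :> R by rewrite ltr0n.
have n1 : 1 <= n%:R :> R by rewrite ler1n.
have ln_ge1 : 1 <= ln n%:R :> R.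
  rewrite -[leLHS]expRK ler_ln ?posrE ?expR_gt0 //; apply: ltW.
  by rewrite -truncn_lt_nat ?expR_ge0.
pose s : R := n%:R / k * (ln n%:R + K).
have s_ge0 : 0 <= s.
  have ln_ge0 : 0 <= ln n%:R :> R by exact: le_trans ln_ge1.
  by rewrite mulr_ge0 ?divr_ge0 ?addr_ge0 // ltW.
exists (Num.truncn s).+1.
  have /andP[le_s _] := truncn_itv s_ge0.
  apply: (@le_trans _ _ (s + 1)); first by rewrite -natr1 lerD2r.
  rewrite mulrDl mul1r lerD //; last by rewrite mulr_ege1.
  rewrite /s [leRHS](_ : _ = n%:R / k * (ln n%:R + K * ln n%:R)); last by ring.
  apply: ler_wpM2l; first by rewrite divr_ge0 // ltW.
  by rewrite lerD2l ler_peMr.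
move=> t le_t; have lt_st : s < t%:R.
  by rewrite -truncn_lt_nat.
apply: (@le_trans _ _ (2 / k * n%:R * expR (- (k / n%:R)) ^+ t)).
  apply: ler_wpM2l; first by rewrite mulr_ge0 // divr_ge0 // ltW.
  rewrite lerXn2r ?nnegrE ?expR_ge0 ?expR_ge1Dx //.
  by rewrite subr_ge0 ler_pdivrMr // mul1r (le_trans k_le1).
rewrite -expRM_natr -ler_pdivlMl; last by rewrite !mulr_gt0 ?invr_gt0.
rewrite -[leRHS]lnK ?posrE; last by rewrite mulr_gt0 // invr_gt0 !mulr_gt0 ?invr_gt0.
rewrite ler_expR.
have -> : (2 / k * n%:R)^-1 * eps = (n%:R * (2 / (k * eps)))^-1.
  by field; rewrite ?gt_eqF.
rewrite lnV ?posrE ?(mulr_gt0 nR r_gt0) //.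
rewrite lnM ?posrE // mulNr lerN2.
rewrite -/K -[leLHS](_ : k / n%:R * s = _); last first.
  by rewrite /s; field; rewrite ?gt_eqF.
by rewrite ler_pM2l ?divr_gt0 // ltW.
Qed.

Theorem theorem3p1 (R : realType) (lambda : R) (Delta : nat)
    (lambda_gt0 : 0 < lambda) (eps : R) (eps_gt0 : 0 < eps) (eps_lt1 : eps < 1) :
  exists (C : R) (N : nat),
    forall (n m : nat) (T : finType) (E : hypergraph T),
      #|T| = n ->
      max_degree E = Delta ->
      min_edge_size E = m ->
      2 * lambda * Delta%:R + 1 <= m%:R ->
      (N <= n)%N ->
      exists2 tau : nat,
        is_mixing_time lambda E eps tau &
        tau%:R <= C * (n%:R * ln n%:R).
Proof.
(* The weights depend on lambda and Delta alone, so C and N are fixed before the hypergraph. *)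
have [c [f [c_gt0 f_ge0 f_noninc f0E f_edge]]] := edge_weights Delta lambda_gt0.
pose G := c + Delta%:R * f 1.
have G_gt0 : 0 < G by rewrite ltr_wpDr // mulr_ge0.
have k_gt0 : 0 < c / G by rewrite divr_gt0.
have k_le1 : c / G <= 1 by rewrite ler_pdivrMr // mul1r lerDl mulr_ge0.
have [C [N horizon]] := mixing_horizon k_gt0 k_le1 eps_gt0 eps_lt1.
exists C, N => n m T E cardT degE sizeE le_m le_n.
have [n_gt0 [t0 le_t0 mix]] := horizon n le_n.
have mixed0 : mixed_from lambda E eps t0.
  move=> t /mix; apply: le_trans.
  have rate_ge0 : 0 <= 1 - c / G / n%:R.
    rewrite subr_ge0 ler_pdivrMr ?ltr0n // mul1r (le_trans k_le1) //.
    by rewrite ler1n.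
  rewrite [leRHS](_ : _ = 4 * (G / c) * n%:R * (1 - c / G / n%:R) ^+ t / 2); last first.
    by field; rewrite ?gt_eqF.
  apply: glauber_dist_le => //; rewrite ?cardT //.
    by rewrite !mulr_ge0 ?exprn_ge0 ?invr_ge0 // ltW.
  move=> F X Y F1; rewrite -cardT /G -degE.
  apply: (iter_glauber_op_diff lambda_gt0 c_gt0 f_ge0 f_noninc) => //.
  - by rewrite degE.
  - by move=> a i; apply: f_edge; rewrite sizeE.
  - by rewrite cardT.
  - exact: indep_valP.
  - exact: indep_valP.
have ex_mixed : exists t, `[<mixed_from lambda E eps t>] by exists t0; exact/asboolP.
exists (ex_minn ex_mixed); case: ex_minnP => tau /asboolP mixed_tau min_tau.
  by split=> // s /asboolP/min_tau.
by apply: le_trans le_t0; rewrite ler_nat; apply: min_tau; exact/asboolP.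
Qed.
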